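(* Let $R$ be a commutative ring and let $\kappa,\lambda$ be cardinals. (i) If $R$ is slender, then $R^{\kappa}\cong_R R^{\lambda}$ implies $\kappa=\lambda$. (ii) If $R$ is w-slender, then $R^{\kappa}\cong_R R^{\lambda}$ if and only if $\kappa=\lambda$.
   Context: Rings are unital and non-zero; ring homomorphisms preserve $1$. For a cardinal $\kappa$, $R^{\kappa}$ is the $R$-module of all functions $\kappa\to R$ (direct product of $\kappa$ copies of $R$), isomorphic to the dual of the free module $R^{[\kappa]}$ (direct sum of $\kappa$ copies of $R$); $e_i$ denotes the $i$-th standard unit vector. A commutative ring $R$ is slender if for every $f\in\mathrm{Hom}_R(R^{\omega},R)$ the set $\{i\in\omega: f(e_i)\ne 0\}$ is finite. A commutative ring $R$ is w-slender (weakly slender) if there is a ring homomorphism $\phi:R\to S$ such that $S$ is a commutative slender ring and $S$, viewed as an $R$-module via $\phi$, is finitely presented. *)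

(* Defs.v *)
From HB Require Import structures.
From mathcomp Require Import all_boot all_algebra.
From mathcomp Require Import boolp classical_sets functions cardinality.

Set Implicit Arguments.
Unset Strict Implicit.
Unset Printing Implicit Defensive.

Import GRing.Theory.

Local Open Scope classical_set_scope.
Local Open Scope card_scope.
Local Open Scope ring_scope.

(* A cardinal is given by a type K of that cardinality; equality of the
   cardinals of K and L is [set: K] #= [set: L], and R^kappa is K -> R^o with
   the pointwise operations. *)
Definition unit_vector (R : comNzRingType) (K : eqType) (i : K) : K -> R^o :=
  fun j => (j == i)%:R.

Definition lmod_isomorphic (R : comNzRingType) (M N : lmodType R) : Prop :=
  exists f : {linear M -> N}, bijective f.

Definition slender (R : comNzRingType) : Prop :=
  forall f : {linear (nat -> R^o) -> R^o},
    finite_set [set i : nat | f (unit_vector R i) != 0].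

(* M is the cokernel of a linear map between free modules of finite rank: there
   is an exact sequence R^m -> R^n -> M -> 0. *)
Definition finitely_presented (R : comNzRingType) (M : lmodType R) : Prop :=
  exists (m n : nat) (q : {linear 'rV[R]_m -> 'rV[R]_n})
         (p : {linear 'rV[R]_n -> M}),
    range p = [set: M] /\ p @^-1` [set 0] = range q.

(* S viewed as an R-module via phi. The type does not depend on phi, but phi
   determines the module structure. *)
Definition restr_scalars (R S : comNzRingType) (phi : {rmorphism R -> S}) : Type :=
  S.

Section RestrScalars.
Variables (R S : comNzRingType) (phi : {rmorphism R -> S}).

HB.instance Definition _ := GRing.Zmodule.copy (restr_scalars phi) S.

Definition restr_scale (a : R) (s : restr_scalars phi) : restr_scalars phi :=
  phi a * (s : S).

Fact restr_scaleA a b s :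
  restr_scale a (restr_scale b s) = restr_scale (a * b) s.
Proof. by rewrite /restr_scale rmorphM mulrA. Qed.

Fact restr_scale1 : left_id 1 restr_scale.
Proof. by move=> s; rewrite /restr_scale rmorph1 mul1r. Qed.

Fact restr_scaleDr : right_distributive restr_scale +%R.
Proof. by move=> a s t; rewrite /restr_scale mulrDr. Qed.

Fact restr_scaleDl s : {morph restr_scale^~ s : a b / a + b}.
Proof. by move=> a b; rewrite /restr_scale rmorphD mulrDl. Qed.

HB.instance Definition _ :=
  GRing.Zmodule_isLmodule.Build R (restr_scalars phi)
    restr_scaleA restr_scale1 restr_scaleDr restr_scaleDl.

End RestrScalars.

Definition w_slender (R : comNzRingType) : Prop :=
  exists (S : comNzRingType) (phi : {rmorphism R -> S}),
    slender S /\ finitely_presented (restr_scalars phi : lmodType R).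

(* Main.v *)
(* For slender R, each coordinate j of an isomorphism F : R^K -> R^L is a
   functional on R^K, hence nonzero on only finitely many unit vectors e_i; and
   as F is injective, every e_i is detected by some coordinate.  So K is a union
   of L-many finite sets, whence |K| <= |L| when L is infinite, with no
   assumption about measurable cardinals.  When both are finite, commutative
   rings have invariant basis number.  When S is slender and finitely presented
   over R, an isomorphism R^K -> R^L induces an S-linear one S^K -> S^L. *)
From HB Require Import structures.
Require Import Defs.
From mathcomp Require Import all_boot all_algebra.
From mathcomp Require Import boolp classical_sets functions cardinality.

Set Implicit Arguments.
Unset Strict Implicit.
Unset Printing Implicit Defensive.

Import GRing.Theory.

Local Open Scope classical_set_scope.
Local Open Scope card_scope.
Local Open Scope ring_scope.

(** * Cardinal arithmetic on types *)

Lemma card_leT_inj (T U : Type) (f : T -> U) :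
  injective f -> [set: T] #<= [set: U].
Proof.
move=> f_inj; have: f @` [set: T] #= [set: T] by apply: inj_card_eq => ? ? _ _ /f_inj.
by rewrite card_eq_le => /andP[_ /card_le_trans]; apply; exact: card_leT.
Qed.

Lemma card_eqT_bij (T U : Type) :
  [set: T] #= [set: U] -> exists f : T -> U, bijective f.
Proof.
case/card_bijP => f [g fK gK].
exists (fun x => val (f (SigSub (mem_set (I : [set: T] x))))).
exists (fun y => val (g (SigSub (mem_set (I : [set: U] y))))) => x.
  rewrite (_ : SigSub _ = f (SigSub (mem_set (I : [set: T] x)))) ?fK//.
  exact: val_inj.
rewrite (_ : SigSub _ = g (SigSub (mem_set (I : [set: U] x)))) ?gK//.
exact: val_inj.
Qed.

Lemma infinite_set_inj (T : Type) (A : set T) : infinite_set A ->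
  exists2 f : nat -> T, injective f & forall n, A (f n).
Proof.
move=> /infiniteP /card_leP[f].
exists (fun n => val (f (SigSub (mem_set (I : [set: nat] n))))).
  move=> m n /val_inj /inj -/(_ (mem_set I) (mem_set I)) /(congr1 val).
  exact.
by move=> n; apply/set_mem/valP.
Qed.

(* A maximal family P of sequences in L that are injective and have pairwise
   disjoint ranges misses only a finite set, so that L embeds in
   P * nat * bool, and then so does L * nat in P * nat. *)
Lemma card_le_prod_nat (L : Type) :
  infinite_set [set: L] -> [set: L * nat] #<= [set: L].
Proof.
move=> L_inf.
pose disj (P : set (nat -> L)) :=
  forall f g, P f -> P g -> forall m n, f m = g n -> f = g /\ m = n.
have [F Fdisj Ftot|P [Pdisj Pmax]] := @Zorn_bigcup _ disj.
  move=> f g [A FA Af] [B FB Bg] m n.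
  by case: (Ftot A B FA FB) => AB; [apply: (Fdisj B)|apply: (Fdisj A)] => //;
    exact: AB.
pose cov := [set x | exists2 f, P f & exists n, f n = x].
have covC_fin : finite_set (~` cov).
  apply: contrapT => /infinite_set_inj[f f_inj fC].
  have NPf : ~ P f by move=> Pf; apply: (fC 0%N); exists f => //; exists 0%N.
  (* The values of [f] avoid [cov], so adjoining [f] keeps the ranges disjoint, against
     maximality. *)
  apply: (Pmax (P `|` [set f])).
    by split=> [g|/(_ f (or_intror erefl))//]; left.
  move=> g h [Pg|->] [Ph|->] m n.
  - exact: Pdisj.
  - by move=> gf; case: (fC n); exists g => //; exists m.
  - by move=> fh; case: (fC m); exists h => //; exists n.
  - by move=> /f_inj.
have [idx idx_inj] := countable_injP _ (finite_set_countable covC_fin).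
(* With [P] empty, all of [L] would be uncovered, hence finite. *)
have [p0 Pp0] : exists p, P p.
  apply: contrapT => NP; apply: L_inf; apply: sub_finite_set covC_fin => x _.
  by case=> f Pf; case: NP; exists f.
(* A covered point is coded by its sequence and position. The uncovered points share the dummy
   sequence [p0]; the flag [true] tells them from points that really lie on [p0]. *)
have /choice[c cP] (x : L) : exists c : (nat -> L) * nat * bool, P c.1.1 /\
    if c.2 then ~ cov x /\ c.1 = (p0, idx x) else c.1.1 c.1.2 = x.
  have [[f Pf [n fn]]|Ncov] := pselect (cov x); first by exists (f, n, false).
  by exists (p0, idx x, true).
have c_inj : injective c.
  move=> x y cxy; have [_ cx] := cP x; have [_ cy] := cP y.
  move: cx cy; rewrite cxy; case: (c y).2 => [[Nx ->] [Ny [ixy]]|-> //].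
  by apply: idx_inj => //; apply/mem_set.
(* The value stays on the sequence that codes the point; position, flag and the extra natural number
   are packed into a new position. Disjointness recovers both sequence and position. *)
pose h (u : L * nat) := (c u.1).1.1 (pickle ((c u.1).1.2, (c u.1).2, u.2)).
apply: (@card_leT_inj _ _ h) => -[x m] [y n].
move/(Pdisj _ _ (cP x).1 (cP y).1) => /= [c1 /(pcan_inj pickleK)[c2 c3 ->]].
congr pair; apply: c_inj; move: c1 c2 c3.
by case: (c x) (c y) => [[? ?] ?] [[? ?] ?] /= -> -> ->.
Qed.

(** Sending [i] to a chosen [j] with [D j i], paired with the index of [i] in an enumeration of
    [D j], embeds [K] in [L * nat]. *)
Lemma card_le_countable_cover (K L : Type) (D : L -> set K) :
    infinite_set [set: L] -> (forall j, countable (D j)) ->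
    (forall i, exists j, D j i) ->
  [set: K] #<= [set: L].
Proof.
move=> L_inf Dcount /choice[c cP].
have /choice[idx idx_inj] j := countable_injP _ (Dcount j).
apply: card_le_trans (card_le_prod_nat L_inf).
apply: (@card_leT_inj _ _ (fun i => (c i, idx (c i) i))) => i k [cik].
by rewrite -cik => /idx_inj; apply; apply/mem_set => //; rewrite cik.
Qed.

(** * Isomorphisms between powers of a ring *)

(** The counterpart of [unit_vector] for index types without decidable equality. *)
Definition delta (R : comNzRingType) (K : Type) (i : K) : K -> R^o :=
  fun j => `[< j = i >]%:R.

Lemma delta_sum (R : comNzRingType) (n : nat) (x : 'I_n -> R^o) :
  x = \sum_i x i *: delta R i.
Proof.
apply/funext => j; rewrite fct_sumE (bigD1 j)//= big1 => [|i ij].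
  by rewrite /delta addr0 fctE asboolT// [RHS]mulr1.
by rewrite /delta fctE asboolF ?[LHS]mulr0// => /esym; apply/eqP.
Qed.

Lemma lmod_isomorphic_can (R : comNzRingType) (M N : lmodType R) :
    lmod_isomorphic M N ->
  exists (f : {linear M -> N}) (g : {linear N -> M}), cancel f g /\ cancel g f.
Proof.
case=> f [g fK gK]; have g_lin : linear g.
  by move=> a x y; apply: (can_inj fK); rewrite linearP !gK.
pose g' : {linear N -> M} := HB.pack g (GRing.isLinear.Build _ _ _ _ g g_lin).
by exists f, g'.
Qed.

Lemma lmod_isomorphic_sym (R : comNzRingType) (M N : lmodType R) :
  lmod_isomorphic M N -> lmod_isomorphic N M.
Proof. by move=> /lmod_isomorphic_can[f [g [fK gK]]]; exists g, f. Qed.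

Lemma lmod_isomorphic_trans (R : comNzRingType) (M N P : lmodType R) :
  lmod_isomorphic M N -> lmod_isomorphic N P -> lmod_isomorphic M P.
Proof. by move=> [f f_bij] [g g_bij]; exists (g \o f); exact: bij_comp. Qed.

Lemma card_eq_lmod_isomorphic (R : comNzRingType) (K L : Type) :
  [set: K] #= [set: L] ->
  lmod_isomorphic ((K -> R^o) : lmodType R) ((L -> R^o) : lmodType R).
Proof.
case/card_eqT_bij => h [h' hK h'K].
pose f (x : K -> R^o) : L -> R^o := x \o h'.
have f_lin : linear f by [].
pose f' : {linear (K -> R^o) -> (L -> R^o)} :=
  HB.pack f (GRing.isLinear.Build _ _ _ _ f f_lin).
exists f', (fun x : L -> R^o => x \o h) => x; apply/funext => i /=.
  by rewrite /f /= hK.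
by rewrite /f /= h'K.
Qed.

(** The matrices of an isomorphism and its inverse multiply to the identity of size [n] through size
    [m], which over a nonzero commutative ring forces the inequality. *)
Lemma lmod_isomorphic_ord_leq (R : comNzRingType) (n m : nat) :
  lmod_isomorphic (('I_n -> R^o) : lmodType R) (('I_m -> R^o) : lmodType R) ->
  (n <= m)%N.
Proof.
move=> /lmod_isomorphic_can[F [G [FK GK]]].
apply: (@mulmx1_min R _ _ (\matrix_(i, j) F (delta R i) j)
                          (\matrix_(j, i) G (delta R j) i)).
apply/matrixP => i k; rewrite !mxE; under eq_bigr do rewrite !mxE.
have -> : (i == k)%:R = G (F (delta R i)) k :> R.
  by rewrite [G _]FK /delta eq_sym; congr (nat_of_bool _)%:R; apply/eqP/asboolP.
rewrite [F _ in RHS]delta_sum linear_sum fct_sumE.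
by apply: eq_bigr => j _; rewrite linearZ.
Qed.

(** * Slender rings *)

Lemma slender_finite_support (R : comNzRingType) (K : Type)
    (f : {linear (K -> R^o) -> R^o}) :
  slender R -> finite_set [set i | f (delta R i) != 0].
Proof.
move=> R_slender; apply: contrapT => /infinite_set_inj[g g_inj fg].
(* Extension by zero along [g] sends the unit vector at [n] to the one at [g n], so [f] composed
   with it would contradict slenderness. *)
pose ext (x : nat -> R^o) : K -> R^o := fun k =>
  if pselect (exists n, g n = k) is left e then x (sval (cid e)) else 0.
have ext_lin : linear ext.
  move=> a x y; apply/funext => k; rewrite /ext !fctE.
  by case: pselect => // _; rewrite scaler0 addr0.
pose ext' : {linear (nat -> R^o) -> (K -> R^o)} :=
  HB.pack ext (GRing.isLinear.Build _ _ _ _ ext ext_lin).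
apply: infinite_nat; apply: sub_finite_set (R_slender (f \o ext')) => n _ /=.
suff -> : ext (unit_vector R n) = delta R (g n) by exact: fg.
apply/funext => k; rewrite /ext /unit_vector /delta.
case: pselect => [e|Ne].
  case: cid => m /= <-; congr (nat_of_bool _)%:R.
  by apply/eqP/asboolP => [->|/g_inj].
by rewrite asboolF// => kgn; apply: Ne; exists n.
Qed.

Section SlenderIso.
Variables (R : comNzRingType) (K L : Type).
Hypothesis R_slender : slender R.
Hypothesis iso :
  lmod_isomorphic ((K -> R^o) : lmodType R) ((L -> R^o) : lmodType R).

Lemma slender_iso_finite_cover : exists D : L -> set K,
  (forall j, finite_set (D j)) /\ (forall i, exists j, D j i).
Proof.
have [F /bij_inj F_inj] := iso.
exists (fun j => [set i | F (delta R i) j != 0]); split=> [j|i].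
  pose Fj x : R^o := F x j.
  have Fj_lin : linear Fj by move=> a x y; rewrite /Fj linearP.
  pose Fj' : {linear (K -> R^o) -> R^o} :=
    HB.pack Fj (GRing.isLinear.Build _ _ _ _ Fj Fj_lin).
  exact: (@slender_finite_support _ _ Fj').
apply: contrapT => NF.
have /F_inj /(congr1 (@^~ i)) : F (delta R i) = F 0.
  rewrite linear0; apply/funext => j; apply/eqP; apply: contrapT => /negP Fij.
  by apply: NF; exists j.
by rewrite /delta asboolT// => /eqP; rewrite oner_eq0.
Qed.

Lemma slender_iso_finite : finite_set [set: L] -> finite_set [set: K].
Proof.
move=> L_fin; have [D [D_fin D_cover]] := slender_iso_finite_cover.
apply: sub_finite_set (bigcup_finite L_fin (fun j _ => D_fin j)) => i _.
by have [j Dji] := D_cover i; exists j.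
Qed.

Lemma slender_iso_card_le : infinite_set [set: L] -> [set: K] #<= [set: L].
Proof.
move=> L_inf; have [D [D_fin D_cover]] := slender_iso_finite_cover.
apply: card_le_countable_cover D_cover => // j.
exact: finite_set_countable.
Qed.

End SlenderIso.

Lemma slender_iso_card_eq (R : comNzRingType) (K L : Type) :
    slender R ->
    lmod_isomorphic ((K -> R^o) : lmodType R) ((L -> R^o) : lmodType R) ->
  [set: K] #= [set: L].
Proof.
move=> R_slender iso; have iso' := lmod_isomorphic_sym iso.
have [L_fin|L_inf] := pselect (finite_set [set: L]); last first.
  (* Both types are then infinite, so the cover argument applies in both directions. *)
  have K_inf : infinite_set [set: K].
    by move=> /(slender_iso_finite R_slender iso').
  by apply: Cantor_Bernstein; exact: (@slender_iso_card_le R).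
have K_fin := slender_iso_finite R_slender iso L_fin.
have [m Lm] := (finite_setP _).1 L_fin.
have [n Kn] := (finite_setP _).1 K_fin.
have {}Lm := card_eq_trans Lm card_II; have {}Kn := card_eq_trans Kn card_II.
have iso_nm : lmod_isomorphic (('I_n -> R^o) : lmodType R)
                              (('I_m -> R^o) : lmodType R).
  apply: lmod_isomorphic_trans (card_eq_lmod_isomorphic R Lm).
  apply: lmod_isomorphic_trans iso.
  by apply: card_eq_lmod_isomorphic; exact: card_esym.
suff nm : n = m by apply: (card_eq_trans Kn); rewrite nm; exact: card_esym.
apply/eqP; rewrite eqn_leq (@lmod_isomorphic_ord_leq R)//=.
by apply: (@lmod_isomorphic_ord_leq R); exact: lmod_isomorphic_sym.
Qed.

(** * Base change along a finitely presented algebra *)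

Section RowLift.
Variables (R : comNzRingType) (K L : Type).

(* F^n, under the identification of (R^n)^K with (R^K)^n. *)
Definition row_lift (n : nat) (F : (K -> R^o) -> (L -> R^o))
    (x : K -> 'rV[R]_n) (l : L) : 'rV[R]_n :=
  \row_k F (fun i => x i 0 k) l.

Variable F : {linear (K -> R^o) -> (L -> R^o)}.

Lemma row_liftB n (x y : K -> 'rV[R]_n) l :
  row_lift F (fun i => x i - y i) l = row_lift F x l - row_lift F y l.
Proof.
apply/rowP => k; rewrite !mxE -[RHS]/((F _ - F _) l) -linearB.
by congr (F _ l); apply/funext => i; rewrite !mxE.
Qed.

Lemma row_liftD n (x y : K -> 'rV[R]_n) l :
  row_lift F (fun i => x i + y i) l = row_lift F x l + row_lift F y l.
Proof.
apply/rowP => k; rewrite !mxE -[RHS]/((F _ + F _) l) -linearD.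
by congr (F _ l); apply/funext => i; rewrite !mxE.
Qed.

Lemma row_lift_mulmx n m (A : 'M[R]_(n, m)) (x : K -> 'rV[R]_n) l :
  row_lift F (fun i => x i *m A) l = row_lift F x l *m A.
Proof.
apply/rowP => k; rewrite !mxE.
rewrite (_ : (fun i => _) = \sum_j A j k *: ((fun i => x i 0 j) : K -> R^o)); last first.
  by apply/funext => i; rewrite mxE fct_sumE; apply: eq_bigr => j _; rewrite mulrC.
rewrite linear_sum fct_sumE; apply: eq_bigr => j _.
by rewrite linearZ mxE mulrC.
Qed.

(** By exactness [x] lifts pointwise through [q] to some [y], which need not depend linearly on [x].
    As [q] is a matrix, the lift of [F] commutes with it, and [p] kills the image of [q]. *)
Lemma row_lift_ker (M : lmodType R) (m n : nat) (q : {linear 'rV[R]_m -> 'rV[R]_n})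
    (p : {linear 'rV[R]_n -> M}) (x : K -> 'rV[R]_n) l :
    p @^-1` [set 0] = range q -> (forall i, p (x i) = 0) ->
  p (row_lift F x l) = 0.
Proof.
move=> pq px0.
have /choice[y xy] i : exists y, x i = y *m lin1_mx q.
  have [y _ <-] : range q (x i) by rewrite -pq; exact: px0.
  by exists y; rewrite mul_rV_lin1.
rewrite (_ : x = fun i => y i *m lin1_mx q); last exact/funext.
rewrite row_lift_mulmx mul_rV_lin1.
by have : (p @^-1` [set 0]) (q (row_lift F y l)) by rewrite pq; exists (row_lift F y l).
Qed.

End RowLift.

Lemma row_liftK (R : comNzRingType) (K L : Type) (n : nat)
    (F : (K -> R^o) -> (L -> R^o)) G (x : K -> 'rV[R]_n) :
  cancel F G -> row_lift G (row_lift F x) = x.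
Proof.
move=> FK; apply/funext => i; apply/rowP => k; rewrite mxE.
rewrite (_ : (fun l => _) = F (fun i => x i 0 k)) ?FK//.
by apply/funext => l; rewrite mxE.
Qed.

(* S^K is the quotient of (R^n)^K by the image of (R^m)^K, and F^n, F^m commute
   with the presentation matrix, so F^n descends to S^K. *)
Lemma lmod_isomorphic_base_change (R S : comNzRingType)
    (phi : {rmorphism R -> S}) (K L : Type) :
    finitely_presented (restr_scalars phi : lmodType R) ->
    lmod_isomorphic ((K -> R^o) : lmodType R) ((L -> R^o) : lmodType R) ->
  lmod_isomorphic ((K -> S^o) : lmodType S) ((L -> S^o) : lmodType S).
Proof.
move=> [m [n [q [p [p_surj pq]]]]] /lmod_isomorphic_can[F [G [FK GK]]].
(* A set-theoretic section of [p], in general not linear. *)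
have /choice[c cK] (s : S) : exists v, p v = s.
  by have [v _ <-] : range p s by [rewrite p_surj]; exists v.
pose descend X Y (H : (X -> R^o) -> (Y -> R^o)) (y : X -> S^o) : Y -> S^o :=
  fun l => p (row_lift H (fun i => c (y i)) l).
(* Any lift may replace the one given by [c]: two lifts differ pointwise by elements of the kernel
   of [p]. *)
have descendE X Y (H : {linear (X -> R^o) -> (Y -> R^o)}) x :
    descend X Y H (fun i => p (x i)) = fun l => p (row_lift H x l).
  apply/funext => l; apply/eqP; rewrite -subr_eq0 -linearB -row_liftB.
  apply/eqP/(row_lift_ker _ _ pq) => i.
  by rewrite linearB /= cK subrr.
have descendK X Y (H : {linear (X -> R^o) -> (Y -> R^o)})
    (H' : {linear (Y -> R^o) -> (X -> R^o)}) :
    cancel H H' -> cancel (descend X Y H) (descend Y X H').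
  by move=> HK y; rewrite descendE row_liftK//; apply/funext => i; exact: cK.
(* Since R^n is free, multiplication by [a] on [S] lifts to a matrix over [R]. The lift of [F]
   commutes with that matrix, which makes the descended map linear over [S] and not just over
   [R]. *)
have mul_lift (a : S) : exists A : 'M[R]_n, forall v, p (v *m A) = a * (p v : S).
  have /choice[r rP] k : exists v, p v = a * (p (delta_mx 0 k) : S).
    by exists (c (a * (p (delta_mx 0 k) : S))); rewrite cK.
  exists (\matrix_k r k) => v; rewrite mulmx_sum_row {2}[v]row_sum_delta.
  rewrite !linear_sum mulr_sumr; apply: eq_bigr => k _.
  by rewrite rowK !linearZ /= rP [LHS]mulrCA.
have descend_lin : linear (descend _ _ F).
  move=> a y z; have [A AP] := mul_lift a.
  rewrite (_ : a *: y + z = fun i => p (c (y i) *m A + c (z i))); last first.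
    by apply/funext => i; rewrite linearD AP !cK.
  rewrite descendE; apply/funext => l.
  by rewrite row_liftD row_lift_mulmx linearD AP.
pose F' : {linear (K -> S^o) -> (L -> S^o)} :=
  HB.pack (descend _ _ F) (GRing.isLinear.Build _ _ _ _ (descend _ _ F) descend_lin).
by exists F', (descend _ _ G); [apply: (descendK _ _ F G)|apply: (descendK _ _ G F)].
Qed.

Theorem theorem6p16 (R : comNzRingType) (K L : Type) :
  (slender R ->
     lmod_isomorphic ((K -> R^o) : lmodType R) ((L -> R^o) : lmodType R) ->
     [set: K] #= [set: L])
  /\
  (w_slender R ->
     (lmod_isomorphic ((K -> R^o) : lmodType R) ((L -> R^o) : lmodType R) <->
      [set: K] #= [set: L])).
Proof.
split=> [|[S [phi [S_slender S_fp]]]]; first exact: slender_iso_card_eq.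
split=> [iso|]; last exact: card_eq_lmod_isomorphic.
apply: slender_iso_card_eq S_slender _.
exact: lmod_isomorphic_base_change S_fp iso.
Qed.
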